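(* For every $\gamma > \frac{\sqrt{2}}{\sqrt{2}-1}$ there is a constant $c_\gamma<\infty$, depending only on $\gamma$, such that the following holds. Let $P \neq Q$ and $R$ be any distributions on $\mathcal{X}$, let $\delta \in (0,1)$, and let $n \geq \frac{c_\gamma \log(1/\delta)}{\mathrm{H}^2(P,Q)}$. Let $X_1,\dots,X_n$ be i.i.d. from $R$. (i) If $\mathrm{H}(Q,R) \geq \gamma\, \mathrm{H}(P,R)$, then $\Pr[\mathrm{T}(P,Q,X^n) > 0] \geq 1-\delta$, so \textsc{HellingerTest} outputs $\mathcal{H}_0$ with probability at least $1-\delta$. (ii) If $\mathrm{H}(P,R) \geq \gamma\, \mathrm{H}(Q,R)$, then $\Pr[\mathrm{T}(P,Q,X^n) < 0] \geq 1-\delta$, so \textsc{HellingerTest} outputs $\mathcal{H}_1$ with probability at least $1-\delta$.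
   Context: Distributions $P,Q,R$ are probability distributions on a measurable space $\mathcal{X}$, identified with their densities with respect to a common $\sigma$-finite reference measure $\mu$ (e.g. Lebesgue measure, or counting measure in the discrete case). All integrals and norms are taken with respect to $\mu$, with $\|U\|_p = (\int |U|^p\, d\mu)^{1/p}$. The Hellinger distance is $\mathrm{H}(P,Q) = \frac{1}{\sqrt{2}}\|\sqrt{P}-\sqrt{Q}\|_2$. For a sample $X^n=(X_1,\dots,X_n)$, the test statistic is $$\mathrm{T}(P,Q,X^n) = \frac{1}{n}\sum_{i=1}^n \frac{P(X_i)-Q(X_i)}{P(X_i)+Q(X_i)},$$ where a summand is interpreted as $0$ whenever $P(X_i)+Q(X_i)=0$. \textsc{HellingerTest} outputs $\mathcal{H}_0$ (the hypothesis ''$P$'') if $\mathrm{T}(P,Q,X^n)>0$, outputs $\mathcal{H}_1$ (the hypothesis ''$Q$'') if $\mathrm{T}(P,Q,X^n)<0$, and breaks ties uniformly at random. *)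

(* Defs.v *)
From HB Require Import structures.
From mathcomp Require Import all_boot all_order all_algebra.
From mathcomp Require Import all_classical all_reals all_analysis.
Set Implicit Arguments. Unset Strict Implicit. Unset Printing Implicit Defensive.
Import Order.TTheory GRing.Theory Num.Theory.
Local Open Scope classical_set_scope.
Local Open Scope ring_scope.

Section Defs.
Context {R : realType} {d : measure_display} {T : measurableType d}.

Definition is_density (mu : {measure set T -> \bar R}) (f : T -> R) : Prop :=
  [/\ measurable_fun setT f, (forall x, 0 <= f x) & (\int[mu]_x (f x)%:E = 1)%E].

Definition distinct_distr (mu : {measure set T -> \bar R}) (P Q : T -> R) : Prop :=
  exists A, measurable A /\
    (\int[mu]_(x in A) (P x)%:E <> \int[mu]_(x in A) (Q x)%:E)%E.

Definition hellinger (mu : {measure set T -> \bar R}) (P Q : T -> R) : R :=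
  (Num.sqrt 2)^-1 *
  Num.sqrt (fine (\int[mu]_x (((Num.sqrt (P x) - Num.sqrt (Q x)) ^+ 2)%:E))).

Definition Tstat (P Q : T -> R) (n : nat) (x : 'I_n -> T) : R :=
  n%:R^-1 * \sum_(i < n)
    (if P (x i) + Q (x i) == 0 then 0
     else (P (x i) - Q (x i)) / (P (x i) + Q (x i))).

Definition iid_sample {dO : measure_display} {Omega : measurableType dO}
  (Pr : probability Omega R) (mu : {measure set T -> \bar R}) (f : T -> R)
  (n : nat) (X : 'I_n -> Omega -> T) : Prop :=
  [/\ (forall i, measurable_fun setT (X i)),
      (forall i A, measurable A ->
         (Pr (X i @^-1` A) = \int[mu]_(x in A) (f x)%:E)%E) &
      (forall A : 'I_n -> set T, (forall i, measurable (A i)) ->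
         Pr (\bigcap_(i in [set: 'I_n]) (X i @^-1` A i)) =
         (\prod_(i < n) Pr (X i @^-1` A i))%E)].

End Defs.

(* Main.v *)
(** Write [p, q, r] for the square roots of the densities [P, Q, R] and [f] for
    [(P - Q) / (P + Q)].  Pointwise,
      [(q - r)^2 / 4 - 3/2 * (p - r)^2 + (P - Q) / 2 <= R * f]  and
      [R * f^2 <= 10 * (p - r)^2 + 8 * (q - r)^2].
    Since [P] and [Q] have the same integral, and [gamma > 3], integrating shows
    that under [R] the mean of [f] is at least, and its second moment at most,
    a constant multiple of [H^2(P, Q)].  As [|f| <= 1], Chernoff's bound for the
    sum of the independent [f (X_i)] concludes. *)
Require Import Defs.
From HB Require Import structures.
From mathcomp Require Import all_boot all_order all_algebra.
From mathcomp Require Import all_classical all_reals all_analysis.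
From mathcomp Require Import measurable_realfun ring lra.
Set Implicit Arguments.
Unset Strict Implicit.
Unset Printing Implicit Defensive.
Import Order.TTheory GRing.Theory Num.Theory.
Local Open Scope classical_set_scope.
Local Open Scope ring_scope.

(** * Integrals against the image of a weighted measure *)

Section change_of_measure.
Import HBNNSimple.
Local Open Scope ereal_scope.

(** The hypothesis is the case where [g] is an indicator; linearity extends it to simple functions
    and monotone convergence to all nonnegative measurable [g]. Below, [h] is either a density, with
    [Y] the identity, or a product of factors independent of [Y]. *)
Lemma ge0_integral_density_pushforward (R : realType)
    (dS dT : measure_display) (S : measurableType dS) (T : measurableType dT)
    (m : {measure set S -> \bar R}) (nu : {measure set T -> \bar R})
    (Y : S -> T) (h : S -> R) (g : T -> R) (c : R) :
  measurable_fun setT Y -> measurable_fun setT h -> measurable_fun setT g ->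
  (forall x, 0 <= h x)%R -> (forall y, 0 <= g y)%R ->
  (forall A, measurable A ->
    \int[m]_(x in Y @^-1` A) (h x)%:E = c%:E * nu A) ->
  \int[m]_x (g (Y x) * h x)%:E = c%:E * \int[nu]_y (g y)%:E.
Proof.
move=> mY mh mg h0 g0 hc.
have mYA A : measurable A -> measurable (Y @^-1` A).
  by move=> mA; rewrite -[X in measurable X]setTI; exact: mY.
have mgE : measurable_fun setT (EFin \o g) by exact/measurable_EFinP.
pose f := nnsfun_approx measurableT mgE.
have cvgf y : EFin \o f^~ y @ \oo --> (g y)%:E.
  by apply: (cvg_nnsfun_approx measurableT mgE) => // x _; rewrite lee_fin.
have cvg_nu : \int[nu]_y (f n y)%:E @[n --> \oo] --> \int[nu]_y (g y)%:E.
  rewrite [X in _ --> X](_ : _ = \int[nu]_y limn (fun n => (f n y)%:E)).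
    apply: cvg_monotone_convergence => //.
    - by move=> n; exact/measurable_EFinP/measurable_funP.
    - by move=> n y _; rewrite lee_fin.
    - by move=> y _ a b ab; rewrite lee_fin; exact/lefP/nd_nnsfun_approx.
  by apply: eq_integral => y _; apply/esym/cvg_lim => //; exact: cvgf.
have cvg_m : \int[m]_x (f n (Y x) * h x)%:E @[n --> \oo] -->
    \int[m]_x (g (Y x) * h x)%:E.
  rewrite [X in _ --> X](_ : _ =
      \int[m]_x limn (fun n => (f n (Y x) * h x)%:E)).
    apply: cvg_monotone_convergence => //.
    - move=> n; apply/measurable_EFinP/measurable_funM => //.
      by apply: measurableT_comp => //; exact: measurable_funP.
    - by move=> n x _; rewrite lee_fin mulr_ge0.
    - move=> x _ a b ab; rewrite lee_fin ler_wpM2r//.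
      exact/lefP/nd_nnsfun_approx.
  apply: eq_integral => x _; apply/esym/cvg_lim => //.
  under eq_fun do rewrite EFinM.
  by rewrite EFinM; apply: cvgeZr => //; exact: cvgf.
have step n : \int[m]_x (f n (Y x) * h x)%:E = c%:E * \int[nu]_y (f n y)%:E.
  have mfr r : measurable (f n @^-1` [set r]) by exact: measurable_sfunP.
  have -> : \int[nu]_y (f n y)%:E =
      \sum_(r \in range (f n)) r%:E * nu (f n @^-1` [set r]).
    under eq_integral do rewrite fimfunE -fsumEFin//.
    rewrite ge0_integral_fsum//.
    + apply: eq_fsbigr => r _; rewrite integralZl_indic_nnsfun//.
      by rewrite integral_indic// setIT.
    + by move=> r; exact/measurable_EFinP/measurable_funM.
    + by move=> r y _; exact: nnfun_muleindic_ge0.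
  (* Nonnegativity is required for every real [r]. A value outside the range of [f n] may be
     negative, but its preimage is empty and the term vanishes. *)
  rewrite ge0_mule_fsumr; last first.
    move=> r; have [[y _ <-]|rf] := pselect (range (f n) r).
      by rewrite mule_ge0// lee_fin.
    suff -> : f n @^-1` [set r] = set0 by rewrite measure0 mule0.
    by apply/seteqP; split => // y /= fy; case: rf; exists y.
  have mrY r : measurable_fun setT
      (fun x => (r * \1_(f n @^-1` [set r]) (Y x))%:E : \bar R).
    apply/measurable_EFinP/measurable_funM => //.
    by apply: measurableT_comp => //; exact: measurable_indic.
  transitivity (\int[m]_x \sum_(r \in range (f n))
      (r * \1_(f n @^-1` [set r]) (Y x))%:E * (h x)%:E).
    apply: eq_integral => x _; rewrite EFinM fimfunE -fsumEFin//.
    by rewrite ge0_mule_fsuml// => r; exact: nnfun_muleindic_ge0.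
  rewrite ge0_integral_fsum//; last 2 first.
  - by move=> r; apply: emeasurable_funM => //; exact/measurable_EFinP.
  - by move=> r x _; rewrite mule_ge0 ?lee_fin// -lee_fin nnfun_muleindic_ge0.
  apply: eq_fsbigr => r /[!inE] -[y _ <-]; set k := f n y.
  under eq_integral do rewrite EFinM -muleA.
  rewrite ge0_integralZl//; last 3 first.
  - apply: emeasurable_funM; last exact/measurable_EFinP.
    by apply/measurable_EFinP; exact: measurableT_comp.
  - by move=> x _; rewrite mule_ge0 ?lee_fin.
  - by rewrite lee_fin.
  rewrite muleCA -hc//; congr (_ * _).
  rewrite [RHS]integral_mkcond; apply: eq_integral => x _.
  by rewrite epatch_indic /= muleC.
apply: (cvg_unique _ cvg_m) => //.
rewrite (funext step).
by apply: cvgeZl.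
Qed.
End change_of_measure.

(** * Expectation of a product of independent factors *)

Section independence.
Local Open Scope ereal_scope.

Lemma integral_prod_independent (R : realType)
    (dO dT : measure_display) (Omega : measurableType dO)
    (T : measurableType dT) (Pr : probability Omega R)
    (n : nat) (X : 'I_n -> Omega -> T) (G : 'I_n -> T -> R) :
  (forall i, measurable_fun setT (X i)) ->
  (forall A : 'I_n -> set T, (forall i, measurable (A i)) ->
     Pr (\bigcap_(i in [set: 'I_n]) (X i @^-1` A i)) =
     \prod_(i < n) Pr (X i @^-1` A i)) ->
  (forall i, measurable_fun setT (G i)) ->
  (forall i x, 0 <= G i x)%R ->
  (forall i, \int[Pr]_w (G i (X i w))%:E \is a fin_num) ->
  \int[Pr]_w (\prod_(i < n) G i (X i w))%:E =
  \prod_(i < n) \int[Pr]_w (G i (X i w))%:E.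
Proof.
move=> mX indep mG G0 finG.
(* The factors are freed one at a time from being indicators: once the identity
   holds for every indicator in position k, it is an equality of measures. *)
suff gen k : (k <= n)%N -> forall F : 'I_n -> T -> R,
    (forall i, measurable_fun setT (F i)) ->
    (forall i x, 0 <= F i x)%R ->
    (forall i, \int[Pr]_w (F i (X i w))%:E \is a fin_num) ->
    (forall i : 'I_n, (k <= i)%N ->
       exists A, measurable A /\ F i = \1_A) ->
    \int[Pr]_w (\prod_(i < n) F i (X i w))%:E =
    \prod_(i < n) \int[Pr]_w (F i (X i w))%:E.
  by apply: (gen n) => // i; rewrite leqNgt ltn_ord.
have mXA i A : measurable A -> measurable (X i @^-1` A).
  by move=> mA; rewrite -[Y in measurable Y]setTI; exact: mX.
have intI i A : measurable A ->
    \int[Pr]_w (\1_A (X i w))%:E = Pr (X i @^-1` A) :> \bar R.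
  by move=> mA; rewrite -[LHS]/(\int[Pr]_w (\1_(X i @^-1` A) w)%:E)
       integral_indic ?setIT//; exact: mXA.
elim: k => [_|k IH kn] F mF F0 finF FI.
  (* When every factor is an indicator, the product is the indicator of the intersection and the
     claim is [indep] itself. *)
  have /boolp.choice[A AF] : forall i, exists A, measurable A /\ F i = \1_A.
    by move=> i; exact: FI.
  have mA i : measurable (A i) by case: (AF i).
  under [RHS]eq_bigr do rewrite (AF _).2 intI//.
  rewrite -indep//.
  have mC : measurable (\bigcap_(i in [set: 'I_n]) (X i @^-1` A i)).
    by apply: fin_bigcap_measurable => // i _; exact: mXA.
  rewrite -[in RHS](setIT (\bigcap_(_ in _) _)) -integral_indic//.
  apply: eq_integral => w _; congr EFin.
  under eq_bigr do rewrite (AF _).2 indicE.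
  rewrite indicE; have [wA|wA] := boolP (w \in _).
    rewrite big1// => i _; move: wA; rewrite inE => /(_ i Logic.I) wA.
    by rewrite mem_set.
  have [i wi] : exists i, ~ A i (X i w).
    apply/existsNP => h; move/negP: wA; apply; rewrite inE => i _.
    exact: h.
  by rewrite (bigD1 i)//= memNset// mul0r.
have kn' : (k < n)%N by [].
pose j := Ordinal kn'.
pose H B i := if i == j then \1_B else F i : T -> R.
have neq B i : i != j -> H B i = F i by rewrite /H => /negPf ->.
(* With position [k] filled by an indicator, the induction hypothesis applies. As [B] varies, the
   identity says that weighting [Pr] by the other factors multiplies the law of [X j] by a
   constant. *)
have HB B : measurable B ->
    \int[Pr]_w (\1_B (X j w) * \prod_(i < n | i != j) F i (X i w))%:E =
    Pr (X j @^-1` B) * \prod_(i < n | i != j) \int[Pr]_w (F i (X i w))%:E.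
  move=> mB.
  transitivity (\int[Pr]_w (\prod_(i < n) H B i (X i w))%:E).
    apply: eq_integral => w _; rewrite [in RHS](bigD1 j)//= {1}/H eqxx.
    by congr (_ * _)%:E; apply: eq_bigr => i ij; rewrite neq.
  rewrite IH ?(ltnW kn)//.
  - rewrite (bigD1 j)//= {1}/H eqxx intI//; congr (_ * _).
    by apply: eq_bigr => i ij; rewrite neq.
  - by move=> i; rewrite /H; case: ifP => // _; exact: measurable_indic.
  - by move=> i x; rewrite /H; case: ifP.
  - move=> i; rewrite /H; case: ifP => // _.
    by rewrite intI// fin_num_measure//; exact: mXA.
  - move=> i ki; rewrite /H; case: eqVneq => [_|ij]; first by exists B.
    by apply: FI; rewrite ltn_neqAle ki andbT eq_sym.
pose h w := (\prod_(i < n | i != j) F i (X i w))%R.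
have [c cE] : exists c : R,
    \prod_(i < n | i != j) \int[Pr]_w (F i (X i w))%:E = c%:E.
  exists (fine (\prod_(i < n | i != j) \int[Pr]_w (F i (X i w))%:E)).
  by rewrite fineK// prode_fin_num.
have mh : measurable_fun setT h.
  rewrite /h; under eq_fun do rewrite -big_filter.
  apply: measurable_prod => i _; exact: measurableT_comp.
rewrite (bigD1 j)//= cE muleC.
under eq_integral do rewrite (bigD1 j)//=.
(* [HB] is exactly the hypothesis on indicators, with weight [h]; the change of measure replaces the
   indicator by [F j]. *)
rewrite (@ge0_integral_density_pushforward _ _ _ _ _ Pr
  (pushforward Pr (X j)) (X j) h (F j) c)//.
- rewrite ge0_integral_pushforward//.
  + exact/measurable_EFinP.
  + by move=> y _; rewrite lee_fin.
- by move=> w; rewrite /h prodr_ge0.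
- move=> B mB; have := HB _ mB; rewrite cE muleC => <-.
  rewrite integral_mkcond; apply: eq_integral => w _.
  by rewrite epatch_indic /= EFinM muleC.
Qed.

End independence.

(** * Pointwise inequalities for the summand of the statistic *)

Section relative_difference.
Context {R : realType}.
Implicit Types a b c p q r t : R.

Definition reldiff a b : R := (a - b) / (a + b).

Lemma reldiffC a b : reldiff b a = - reldiff a b.
Proof. by rewrite /reldiff -mulNr opprB (addrC b a). Qed.

Lemma reldiff_bounds a b : 0 <= a -> 0 <= b -> -1 <= reldiff a b <= 1.
Proof.
move=> a0 b0; rewrite /reldiff; have [->|ab] := eqVneq (a + b) 0.
  by rewrite invr0 mulr0; lra.
have ab0 : 0 < a + b by rewrite lt_neqAle eq_sym ab addr_ge0.
by rewrite ler_pdivlMr// ler_pdivrMr//; lra.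
Qed.

(* Writing D for the difference of the two sides multiplied by p^2 + q^2, one
   has 4 (9 p^2 + q^2) D = (square) + 12 (p^2 + q^2) p q (p - q)^2. *)
Lemma reldiff_mean_ge p q r : 0 <= p -> 0 <= q ->
  (q - r) ^+ 2 / 4 - 3 / 2 * (p - r) ^+ 2 + (p ^+ 2 - q ^+ 2) / 2 <=
  r ^+ 2 * reldiff (p ^+ 2) (q ^+ 2).
Proof.
move=> p0 q0; rewrite /reldiff.
have [s0|s0] := eqVneq (p ^+ 2 + q ^+ 2) 0.
  have p2 := sqr_ge0 p; have q2 := sqr_ge0 q.
  have /eqP : p ^+ 2 = 0 by lra.
  have /eqP : q ^+ 2 = 0 by lra.
  rewrite !sqrf_eq0 => /eqP -> /eqP ->; have := sqr_ge0 r; nra.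
have sp : 0 < p ^+ 2 + q ^+ 2 by rewrite lt_neqAle eq_sym s0 addr_ge0// sqr_ge0.
rewrite mulrA ler_pdivlMr// -subr_ge0.
(* [a / 4] is the coefficient of [r ^+ 2] in the difference, so multiplying by [a] completes the
   square in [r]. *)
set a := 9 * p ^+ 2 + q ^+ 2.
have a0 : 0 < a by rewrite /a; have := sqr_ge0 p; lra.
rewrite -(pmulr_rge0 _ a0).
rewrite [leRHS](_ : _ = ((a * r + (q - 6 * p) * (p ^+ 2 + q ^+ 2)) ^+ 2 +
   12 * (p ^+ 2 + q ^+ 2) * (p * q) * (p - q) ^+ 2) / 4);
  last by rewrite /a; field.
rewrite divr_ge0// addr_ge0 ?sqr_ge0// mulr_ge0 ?sqr_ge0//.
by rewrite !mulr_ge0 ?(ltW sp).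
Qed.

(** Factor [p ^+ 2 - q ^+ 2] as [(p - q) * (p + q)], then use [p ^+ 2 <= p ^+ 2 + q ^+ 2] and
    [(p + q) ^+ 2 <= 2 * (p ^+ 2 + q ^+ 2)]. *)
Lemma sqr_reldiff_le p q :
  p ^+ 2 * reldiff (p ^+ 2) (q ^+ 2) ^+ 2 <= 2 * (p - q) ^+ 2.
Proof.
rewrite /reldiff; have [->|s0] := eqVneq (p ^+ 2 + q ^+ 2) 0.
  by rewrite invr0 mulr0 expr0n /= mulr0 mulr_ge0// sqr_ge0.
have sp : 0 < p ^+ 2 + q ^+ 2 by rewrite lt_neqAle eq_sym s0 addr_ge0// sqr_ge0.
rewrite expr_div_n mulrA ler_pdivrMr ?exprn_gt0// -subr_ge0.
rewrite [leRHS](_ : _ = (p - q) ^+ 2 *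
  (q ^+ 2 * (p + q) ^+ 2 + (p ^+ 2 + q ^+ 2) * (p - q) ^+ 2)); last by ring.
by rewrite mulr_ge0 ?sqr_ge0// addr_ge0// mulr_ge0 ?sqr_ge0// ltW.
Qed.

(** Split [r ^+ 2 <= 2 * (p - r) ^+ 2 + 2 * p ^+ 2]. In the first term the squared relative
    difference is at most 1; the second is at most [4 * (p - q) ^+ 2] by [sqr_reldiff_le], and
    [p - q] is compared through [r]. This gives 2 + 8 = 10 and 8. *)
Lemma reldiff_second_moment_le p q r :
  r ^+ 2 * reldiff (p ^+ 2) (q ^+ 2) ^+ 2 <=
  10 * (p - r) ^+ 2 + 8 * (q - r) ^+ 2.
Proof.
have := sqr_reldiff_le p q.
have := reldiff_bounds (sqr_ge0 p) (sqr_ge0 q).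
set f := reldiff _ _ => /andP[f1 f2] pf.
have f21 : f ^+ 2 <= 1 by nra.
have h1 : r ^+ 2 * f ^+ 2 <=
    2 * ((p - r) ^+ 2 * f ^+ 2) + 2 * (p ^+ 2 * f ^+ 2).
  rewrite -subr_ge0 [leRHS](_ : _ = (2 * p - r) ^+ 2 * f ^+ 2); last by ring.
  by rewrite mulr_ge0 ?sqr_ge0.
have h2 : (p - r) ^+ 2 * f ^+ 2 <= (p - r) ^+ 2 by rewrite ler_piMr ?sqr_ge0.
have h3 := sqr_ge0 (p + q - 2 * r).
have h4 : (p - q) ^+ 2 <= 2 * (p - r) ^+ 2 + 2 * (q - r) ^+ 2 by nra.
lra.
Qed.

(* A rational majorant of exp (- t * reldiff a b). *)
Definition tilt t a b : R := (1 + t * reldiff a b)^-1.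

Lemma scaled_reldiff_bounds t a b : 0 <= t <= 2^-1 -> 0 <= a -> 0 <= b ->
  - 2^-1 <= t * reldiff a b <= 2^-1.
Proof.
move=> /andP[t0 t1] a0 b0; have /andP[f1 f2] := reldiff_bounds a0 b0.
have := ler_wpM2l t0 f1; have := ler_wpM2l t0 f2; lra.
Qed.

Lemma tilt_ge0 t a b : 0 <= t <= 2^-1 -> 0 <= a -> 0 <= b -> 0 <= tilt t a b.
Proof.
move=> t01 a0 b0; have := scaled_reldiff_bounds t01 a0 b0.
by rewrite invr_ge0; lra.
Qed.

Lemma tilt_le2 t a b : 0 <= t <= 2^-1 -> 0 <= a -> 0 <= b -> tilt t a b <= 2.
Proof.
move=> t01 a0 b0; have f1 := scaled_reldiff_bounds t01 a0 b0.
by rewrite /tilt invf_ple ?posrE; lra.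
Qed.

(** Invert [1 + u <= expR u] at [u = t * reldiff a b]; the bound on [t] keeps [1 + u] positive. *)
Lemma expR_le_tilt t a b : 0 <= t <= 2^-1 -> 0 <= a -> 0 <= b ->
  expR (- (t * reldiff a b)) <= tilt t a b.
Proof.
move=> t01 a0 b0; have f1 := scaled_reldiff_bounds t01 a0 b0.
by rewrite expRN /tilt lef_pV2 ?posrE ?expR_gt0 ?expR_ge1Dx//; lra.
Qed.

(** For [u >= - 2^-1] one has [(1 + u)^-1 <= 1 - u + 2 * u ^+ 2]. The linear and quadratic terms in
    [u] are then bounded by the first and second moment inequalities at the square roots. *)
Lemma tilt_weighted_le t a b c : 0 <= t <= 2^-1 ->
    0 <= a -> 0 <= b -> 0 <= c ->
  c * tilt t a b <= c
    - t * ((Num.sqrt b - Num.sqrt c) ^+ 2 / 4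
           - 3 / 2 * (Num.sqrt a - Num.sqrt c) ^+ 2 + (a - b) / 2)
    + 2 * t ^+ 2 * (10 * (Num.sqrt a - Num.sqrt c) ^+ 2
                    + 8 * (Num.sqrt b - Num.sqrt c) ^+ 2).
Proof.
move=> t01 a0 b0 c0; have f1 := scaled_reldiff_bounds t01 a0 b0.
have := reldiff_mean_ge (Num.sqrt c) (sqrtr_ge0 a) (sqrtr_ge0 b).
have := reldiff_second_moment_le (Num.sqrt a) (Num.sqrt b) (Num.sqrt c).
rewrite !sqr_sqrtr//; set X := (_ - _) ^+ 2; set Y := (_ - _) ^+ 2 => h2 h1.
have : c * tilt t a b <=
    c * (1 - t * reldiff a b + 2 * (t * reldiff a b) ^+ 2).
  rewrite ler_wpM2l// /tilt -[leLHS]mul1r ler_pdivrMr; last by lra.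
  set u := t * _.
  rewrite -subr_ge0 [leRHS](_ : _ = u ^+ 2 * (1 + 2 * u)); last by ring.
  by rewrite mulr_ge0 ?sqr_ge0// /u; lra.
have t0 : 0 <= t by case/andP: t01.
have := ler_wpM2l t0 h1.
have := ler_wpM2l (mulr_ge0 (ler0n R 2) (sqr_ge0 t)) h2.
set f := reldiff a b.
have -> : 2 * t ^+ 2 * (c * f ^+ 2) = 2 * (c * (t * f) ^+ 2) by ring.
have -> : t * (c * f) = c * (t * f) by ring.
lra.
Qed.

End relative_difference.

(** * Hellinger distance and the integrated bound on the tilt *)

Section hellinger_lemmas.
Context {R : realType} {d : measure_display} {T : measurableType d}.
Variable mu : {measure set T -> \bar R}.
Implicit Types (P Q S : T -> R) (t : R).

(** Twice the squared Hellinger distance, kept as a real integral so that the estimates become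
    linear arithmetic. *)
Definition sqdist P Q : R :=
  \int[mu]_x ((Num.sqrt (P x) - Num.sqrt (Q x)) ^+ 2).

Lemma sqdistC P Q : sqdist P Q = sqdist Q P.
Proof. by apply: eq_Rintegral => x _; rewrite -sqrrN opprB. Qed.

Lemma sqdist_ge0 P Q : 0 <= sqdist P Q.
Proof. by apply: Rintegral_ge0 => x _; rewrite sqr_ge0. Qed.

Lemma hellinger_sqr P Q : hellinger mu P Q ^+ 2 = sqdist P Q / 2.
Proof.
rewrite /hellinger -[fine _]/(sqdist P Q) exprMn exprVn.
by rewrite sqr_sqrtr// sqr_sqrtr ?sqdist_ge0// mulrC.
Qed.

Lemma hellingerC P Q : hellinger mu P Q = hellinger mu Q P.
Proof. by congr (_ * Num.sqrt _); exact: sqdistC. Qed.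

Lemma hellinger_ge0 P Q : 0 <= hellinger mu P Q.
Proof. by rewrite mulr_ge0 ?invr_ge0 ?sqrtr_ge0. Qed.

Lemma measurable_sqrt_comp P : measurable_fun setT P ->
  measurable_fun setT (fun x => Num.sqrt (P x)).
Proof.
move=> mP; apply: measurableT_comp => //.
by apply: continuous_measurable_fun; exact: sqrt_continuous.
Qed.

Lemma measurable_reldiff P Q :
  measurable_fun setT P -> measurable_fun setT Q ->
  (forall x, 0 <= P x) -> (forall x, 0 <= Q x) ->
  measurable_fun setT (fun x => reldiff (P x) (Q x)).
Proof.
move=> mP mQ P0 Q0; apply: measurable_funM; first exact: measurable_funB.
(* On nonnegative reals the inverse is the power -1, at 0 as well, where both are 0; the power
   function is measurable. *)
under eq_fun do rewrite -powR_inv1 ?addr_ge0//.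
apply: (@measurableT_comp _ _ _ _ _ _ (fun x => x `^ (-1))) => //.
exact: measurable_funD.
Qed.

Lemma measurable_tilt t P Q : 0 <= t <= 2^-1 ->
  measurable_fun setT P -> measurable_fun setT Q ->
  (forall x, 0 <= P x) -> (forall x, 0 <= Q x) ->
  measurable_fun setT (fun x => tilt t (P x) (Q x)).
Proof.
move=> t01 mP mQ P0 Q0; have mf := measurable_reldiff mP mQ P0 Q0.
have f1 x : 0 <= 1 + t * reldiff (P x) (Q x).
  by have := scaled_reldiff_bounds t01 (P0 x) (Q0 x); lra.
rewrite /tilt; under eq_fun do rewrite -powR_inv1//.
apply: (@measurableT_comp _ _ _ _ _ _ (fun x => x `^ (-1))) => //.
by apply: measurable_funD => //; exact: measurable_funM.
Qed.

Lemma density_integrable P : is_density mu P ->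
  mu.-integrable setT (EFin \o P).
Proof.
move=> [mP P0 P1]; apply/integrableP; split; first exact/measurable_EFinP.
under eq_integral do rewrite /= ger0_norm//.
by rewrite P1 ltry.
Qed.

Lemma density_Rintegral P : is_density mu P -> \int[mu]_x P x = 1.
Proof. by case=> _ _ P1; rewrite /Rintegral P1. Qed.

Lemma sqdist_integrable P Q : is_density mu P -> is_density mu Q ->
  mu.-integrable setT
    (EFin \o (fun x => (Num.sqrt (P x) - Num.sqrt (Q x)) ^+ 2)).
Proof.
move=> dP dQ; have [mP P0 _] := dP; have [mQ Q0 _] := dQ.
apply: (le_integrable measurableT _ _
  (integrableD measurableT (density_integrable dP) (density_integrable dQ))).
  by apply/measurable_EFinP/measurable_funX/measurable_funB;
     exact: measurable_sqrt_comp.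
move=> x _; rewrite /= lee_fin ger0_norm ?sqr_ge0// ger0_norm ?addr_ge0//.
have := sqr_sqrtr (P0 x); have := sqr_sqrtr (Q0 x).
have := mulr_ge0 (sqrtr_ge0 (P x)) (sqrtr_ge0 (Q x)); nra.
Qed.

(** A zero distance forces equal square roots almost everywhere, hence equal densities almost
    everywhere and equal integrals over every measurable set. *)
Lemma sqdist_gt0 P Q : is_density mu P -> is_density mu Q ->
  distinct_distr mu P Q -> 0 < sqdist P Q.
Proof.
move=> dP dQ [A [mA PQA]]; have [mP P0 _] := dP; have [mQ Q0 _] := dQ.
rewrite lt_neqAle sqdist_ge0 andbT eq_sym; apply/eqP => PQ0.
have iPQ := sqdist_integrable dP dQ.
have mPQ := measurable_int _ iPQ.
apply: PQA; apply: ae_eq_integral => //.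
- exact/measurable_EFinP/measurable_funTS.
- exact/measurable_EFinP/measurable_funTS.
have /(ae_eq_integral_abs mu measurableT mPQ) : (\int[mu]_x `|(EFin \o
    (fun x => (Num.sqrt (P x) - Num.sqrt (Q x)) ^+ 2)%R) x| = 0)%E.
  under eq_integral do rewrite /= ger0_norm ?sqr_ge0//.
  rewrite -[LHS]fineK; last exact: (integrable_fin_num measurableT iPQ).
  by rewrite -[fine _]/(sqdist P Q) PQ0.
apply: filterS => x /(_ Logic.I) /= [] /eqP + _.
rewrite sqrf_eq0 subr_eq0 => /eqP PQx.
by rewrite -(sqr_sqrtr (P0 x)) PQx sqr_sqrtr.
Qed.

(** Pointwise, the right side minus the left is the square of
    [Num.sqrt P + Num.sqrt Q - 2 * Num.sqrt S]. *)
Lemma sqdist_le P Q S :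
  is_density mu P -> is_density mu Q -> is_density mu S ->
  sqdist P Q <= 2 * sqdist P S + 2 * sqdist Q S.
Proof.
move=> dP dQ dS; have iPQ := sqdist_integrable dP dQ.
have iPS := sqdist_integrable dP dS; have iQS := sqdist_integrable dQ dS.
have i1 := integrableZl measurableT 2 iPS.
have i2 := integrableZl measurableT 2 iQS.
rewrite /sqdist -!RintegralZl// -RintegralD//.
apply: le_Rintegral => //; first exact: (integrableD measurableT i1 i2).
move=> x _.
have := sqr_ge0 (Num.sqrt (P x) + Num.sqrt (Q x) - 2 * Num.sqrt (S x)); nra.
Qed.

(** The one-sample Chernoff factor, obtained by integrating [tilt_weighted_le]. The factor 9 is the
    square of the ratio 3 between Hellinger distances. *)
Lemma tilt_integral_le t P Q S : 0 <= t <= 480^-1 ->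
  is_density mu P -> is_density mu Q -> is_density mu S ->
  9 * sqdist P S <= sqdist Q S ->
  (\int[mu]_x (S x * tilt t (P x) (Q x))%:E <=
     (1 - t * (sqdist P Q / 60))%:E)%E.
Proof.
move=> t480 dP dQ dS PSQS; have t01 : 0 <= t <= 2^-1 by lra.
have [mP P0 _] := dP; have [mQ Q0 _] := dQ; have [mS S0 _] := dS.
have iPS := sqdist_integrable dP dS; have iQS := sqdist_integrable dQ dS.
have iP := density_integrable dP; have iQ := density_integrable dQ.
have iS := density_integrable dS.
have iL : mu.-integrable setT (EFin \o (fun x => S x * tilt t (P x) (Q x))).
  apply: (le_integrable measurableT _ _ (integrableZl measurableT 2 iS)).
    by apply/measurable_EFinP/measurable_funM => //; exact: measurable_tilt.
  move=> x _; rewrite /= lee_fin ger0_norm ?mulr_ge0 ?tilt_ge0//.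
  by rewrite ger0_norm ?mulr_ge0// mulrC ler_wpM2r// tilt_le2.
rewrite -[leLHS]fineK; last exact: (integrable_fin_num measurableT iL).
rewrite lee_fin -[fine _]/(\int[mu]_x (S x * tilt t (P x) (Q x))).
(* Coefficients of the two squared differences once the terms of [tilt_weighted_le] are collected.
   The terms in [P] and [Q] cancel after integration, both densities having mass 1. *)
pose kX := t * (3 / 2) + 20 * t ^+ 2; pose kY := - (t / 4) + 16 * t ^+ 2.
pose B x := S x + (kX * (Num.sqrt (P x) - Num.sqrt (S x)) ^+ 2 +
  (kY * (Num.sqrt (Q x) - Num.sqrt (S x)) ^+ 2 +
  (t / 2 * Q x + (- (t / 2)) * P x))).
have i1 := integrableZl measurableT kX iPS.
have i2 := integrableZl measurableT kY iQS.
have i3 := integrableZl measurableT (t / 2) iQ.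
have i4 := integrableZl measurableT (- (t / 2)) iP.
have i34 := integrableD measurableT i3 i4.
have i234 := integrableD measurableT i2 i34.
have i1234 := integrableD measurableT i1 i234.
have iB := integrableD measurableT iS i1234.
have : \int[mu]_x (S x * tilt t (P x) (Q x)) <= \int[mu]_x B x.
  apply: le_Rintegral => // x _.
  apply: le_trans (tilt_weighted_le t01 (P0 x) (Q0 x) (S0 x)) _.
  by rewrite le_eqVlt; apply/orP; left; apply/eqP; rewrite /B /kX /kY; field.
rewrite /B RintegralD// RintegralD// RintegralD// RintegralD// !RintegralZl//.
rewrite (density_Rintegral dP) (density_Rintegral dQ) (density_Rintegral dS).
rewrite -/(sqdist P S) -/(sqdist Q S) => /le_trans; apply.
have PQ := sqdist_le dP dQ dS.
have X0 := sqdist_ge0 P S; have Y0 := sqdist_ge0 Q S.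
move: (sqdist P Q) (sqdist P S) (sqdist Q S) PSQS PQ X0 Y0.
move=> h X Y XY hXY X0 Y0.
have /andP[t0 t1] := t480.
have V0 : 0 <= 20 * X + 16 * Y by lra.
have tV := ler_wpM2r V0 t1.
(* Since [X <= Y / 9], the right factor is at least [Y / 12]. On the left, [h <= 2 * X + 2 * Y]
   gives [h / 60 <= Y / 27], and [t <= 480^-1] bounds the other term by about [0.038 * Y], for a
   total below [Y / 12]. *)
have : t * (h / 60 + t * (20 * X + 16 * Y)) <= t * (Y / 4 - 3 / 2 * X).
  by rewrite ler_wpM2l//; lra.
clear - t; rewrite /kX /kY; lra.
Qed.

(** Division by zero yields 0, so [reldiff] already carries the convention for points where both
    densities vanish. *)
Lemma TstatE (P Q : T -> R) (n : nat) (x : 'I_n -> T) :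
  Tstat P Q x = n%:R^-1 * \sum_(i < n) reldiff (P (x i)) (Q (x i)).
Proof.
congr (_ * _); apply: eq_bigr => i _; rewrite /reldiff.
by case: eqP => // ->; rewrite invr0 mulr0.
Qed.

End hellinger_lemmas.

(** * Error probability of the test *)

(** One of the two symmetric claims, at ratio 3 and with the Chernoff parameter [t] left free. *)
Lemma hellinger_test_error (R : realType) (d : measure_display)
    (T : measurableType d) (mu : {measure set T -> \bar R})
    (P Q S : T -> R) (delta t : R) (n : nat) (dO : measure_display)
    (Omega : measurableType dO) (Pr : probability Omega R)
    (X : 'I_n -> Omega -> T) :
  is_density mu P -> is_density mu Q -> is_density mu S ->
  distinct_distr mu P Q -> 0 < delta -> 0 < t <= 480^-1 ->
  30 / t * ln delta^-1 / hellinger mu P Q ^+ 2 <= n%:R ->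
  iid_sample Pr mu S X ->
  3 * hellinger mu P S <= hellinger mu Q S ->
  ((1 - delta)%:E <= Pr [set w | (0 < Tstat P Q (fun i => X i w))%R])%E.
Proof.
move=> dP dQ dS dPQ delta0 /andP[t0 t480] hn [mX lawX indep] PSQS.
have [mP P0 _] := dP; have [mQ Q0 _] := dQ; have [mS S0 _] := dS.
have t01 : 0 <= t <= 2^-1 by lra.
pose W x := tilt t (P x) (Q x).
have mW : measurable_fun setT W by exact: measurable_tilt.
have W0 x : 0 <= W x by exact: tilt_ge0.
have h0 := sqdist_gt0 dP dQ dPQ.
have sqPSQS : 9 * sqdist mu P S <= sqdist mu Q S.
  have : (3 * hellinger mu P S) ^+ 2 <= hellinger mu Q S ^+ 2.
    by rewrite ler_sqr ?nnegrE ?mulr_ge0 ?hellinger_ge0.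
  by clear; rewrite exprMn !hellinger_sqr; lra.
(* The change of measure with [Y] the identity and weight [S] turns the law of [X i] into an
   integral against [mu]. *)
have EW i : (\int[Pr]_w (W (X i w))%:E = \int[mu]_x (S x * W x)%:E)%E.
  under [RHS]eq_integral do rewrite mulrC.
  rewrite (@ge0_integral_density_pushforward _ _ _ _ _ mu
    (pushforward Pr (X i)) id S W 1)//.
    rewrite mul1e ge0_integral_pushforward//; first exact/measurable_EFinP.
    by move=> y _; rewrite lee_fin.
  by move=> A mA; rewrite mul1e preimage_id -(lawX i).
have EWle i : (\int[Pr]_w (W (X i w))%:E <=
    (1 - t * (sqdist mu P Q / 60))%:E)%E.
  by rewrite EW; apply: tilt_integral_le => //; rewrite ltW.
have EW0 i : (0 <= \int[Pr]_w (W (X i w))%:E)%E.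
  by apply: integral_ge0 => w _; rewrite lee_fin.
have EWfin i : (\int[Pr]_w (W (X i w))%:E \is a fin_num)%E.
  by rewrite ge0_fin_numE// (le_lt_trans (EWle i)) ?ltry.
have mprodW : measurable_fun setT (fun w => \prod_(i < n) W (X i w)).
  by apply: measurable_prod => i _; exact: measurableT_comp.
have prodW0 w : 0 <= \prod_(i < n) W (X i w) by exact: prodr_ge0.
(* By independence and [1 + x <= expR x], the expectation is at most
   [expR (- (n * t * sqdist / 60))]. The squared Hellinger distance is [sqdist / 2], so the constant
   [30 / t] makes the exponent at most [ln delta]. *)
have chernoff : (\int[Pr]_w (\prod_(i < n) W (X i w))%:E <= delta%:E)%E.
  rewrite (@integral_prod_independent _ _ _ _ _ Pr n X (fun=> W))//.
  under eq_bigr do rewrite -[integral _ _ _]fineK ?EWfin//.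
  rewrite prodEFin lee_fin.
  apply: (@le_trans _ _
    (\prod_(i < n) expR (- (t * (sqdist mu P Q / 60))))).
    apply: ler_prod => i _; rewrite fine_ge0//=.
    apply: le_trans (expR_ge1Dx _).
    by rewrite -lee_fin fineK.
  rewrite prodr_const card_ord -expRM_natl -[leRHS]lnK ?posrE// ler_expR.
  move: hn; rewrite hellinger_sqr lnV ?posrE// ler_pdivrMr ?divr_gt0//.
  move=> /(ler_wpM2l (ltW t0)).
  have -> : t * (30 / t * - ln delta) = - 30 * ln delta.
    by field; rewrite gt_eqF.
  by clear; lra.
have mtest : measurable_fun setT (fun w => Tstat P Q (fun i => X i w)).
  under eq_fun do rewrite TstatE.
  apply: measurable_funM => //; apply: measurable_sum => i.
  apply: (@measurableT_comp _ _ _ _ _ _ (fun x => reldiff (P x) (Q x))) => //.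
  exact: measurable_reldiff.
have mpos : measurable [set w | 0 < Tstat P Q (fun i => X i w)].
  rewrite -[Y in measurable Y]setTI.
  exact: (@measurable_fun_ltr _ _ _ _ (cst 0) _ _ mtest measurableT [set true]).
(* Markov's inequality: where the statistic is at most 0, each tilt dominates an exponential and the
   product of these exponentials is at least 1, so the indicator lies below the product of tilts. *)
have : (Pr (~` [set w | (0 < Tstat P Q (fun i => X i w))%R]) <= delta%:E)%E.
  apply: le_trans chernoff.
  rewrite -[Y in Pr Y]setIT -integral_indic//; last exact: measurableC.
  apply: ge0_le_integral => //.
  - by apply/measurable_EFinP/measurable_indic; exact: measurableC.
  - exact/measurable_EFinP.
  move=> w _; rewrite lee_fin indicE; case: (boolP (w \in _)) => //.
  rewrite inE /= => /negP; rewrite -leNgt TstatE => T0.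
  have sum0 : \sum_(i < n) reldiff (P (X i w)) (Q (X i w)) <= 0.
    (* For [n = 0] the factor [n%:R^-1] is 0 and cannot be cancelled, but the sum is empty. *)
    have [n0|n0] := posnP n.
      by rewrite big1// => i _; have := ltn_ord i; rewrite {2}n0.
    by move: T0; rewrite pmulr_rle0// invr_gt0 ltr0n.
  apply: (@le_trans _ _
    (\prod_(i < n) expR (- (t * reldiff (P (X i w)) (Q (X i w)))))).
    rewrite -expR_sum sumrN -mulr_sumr.
    by rewrite -[leLHS]expR0 ler_expR oppr_ge0 mulr_ge0_le0// ltW.
  by apply: ler_prod => i _; rewrite expR_ge0 expR_le_tilt.
rewrite probability_setC// EFinB -[X in (1 - X)%E]fineK ?fin_num_measure//.
rewrite -[in X in _ -> X](@fineK _ (Pr _)) ?fin_num_measure//.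
by rewrite -!EFinB !lee_fin; clear; lra.
Qed.

Theorem theorem1 (R : realType) (gamma : R) :
  Num.sqrt 2 / (Num.sqrt 2 - 1) < gamma ->
  exists c : R, forall (d : measure_display) (T : measurableType d)
    (mu : {measure set T -> \bar R}) (P Q Rd : T -> R) (delta : R) (n : nat)
    (dO : measure_display) (Omega : measurableType dO)
    (Pr : probability Omega R) (X : 'I_n -> Omega -> T),
    sigma_finite setT mu ->
    is_density mu P -> is_density mu Q -> is_density mu Rd ->
    distinct_distr mu P Q ->
    0 < delta < 1 ->
    c * ln (delta^-1) / (hellinger mu P Q ^+ 2) <= n%:R ->
    iid_sample Pr mu Rd X ->
    (gamma * hellinger mu P Rd <= hellinger mu Q Rd ->
       ((1 - delta)%:E <= Pr [set w | (0 < Tstat P Q (fun i => X i w))%R])%E) /\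
    (gamma * hellinger mu Q Rd <= hellinger mu P Rd ->
       ((1 - delta)%:E <= Pr [set w | (Tstat P Q (fun i => X i w) < 0)%R])%E).
Proof.
move=> gt_gamma.
(* The threshold equals [2 + Num.sqrt 2], which exceeds 3. *)
have gamma3 : 3 <= gamma.
  apply: le_trans (ltW gt_gamma).
  have s2 : Num.sqrt 2 ^+ 2 = 2 :> R by rewrite sqr_sqrtr.
  have s0 : 0 <= Num.sqrt 2 :> R := sqrtr_ge0 _.
  by rewrite ler_pdivlMr; nra.
have t480 : 0 < (480^-1 : R) <= 480^-1 by rewrite lexx andbT invr_gt0.
(* This is [30 / t] at the largest value of [t] allowed by [hellinger_test_error]. *)
exists (30 / 480^-1) => d T mu P Q Rd delta n dO Omega Pr X _ dP dQ dR dPQ.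
move=> /andP[delta0 _] hn iid; split => far.
  apply: (hellinger_test_error dP dQ dR dPQ delta0 t480 hn iid).
  by apply: le_trans far; rewrite ler_wpM2r ?hellinger_ge0.
(* The second claim is the first with [P] and [Q] exchanged: the distance is symmetric and the
   statistic changes sign. *)
have dQP : distinct_distr mu Q P.
  by have [A [mA PQA]] := dPQ; exists A; split => //; exact: nesym.
rewrite hellingerC in hn.
have -> : [set w | Tstat P Q (fun i => X i w) < 0] =
    [set w | 0 < Tstat Q P (fun i => X i w)].
  apply/seteqP; split => w /=; rewrite !TstatE;
    by under [in X in _ -> X]eq_bigr do rewrite reldiffC;
       rewrite sumrN mulrN ?oppr_gt0 ?oppr_lt0.
apply: (hellinger_test_error dQ dP dR dQP delta0 t480 hn iid).
by apply: le_trans far; rewrite ler_wpM2r ?hellinger_ge0.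
Qed.
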